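(* Let $f(z)=z+\sum_{n=2}^{\infty} a_n z^n$ be in the class $\mathcal{K}_{\sigma}$ of bi-convex functions. Then $$\left| a_2 a_4-a_3^2\right| \leq \frac{1}{3}.$$
   Context: Let $\mathcal{U}=\{z\in\mathbb{C}:|z|<1\}$. Let $\mathcal{A}$ be the family of functions $f$ analytic in $\mathcal{U}$ of the form $f(z)=z+\sum_{n=2}^{\infty}a_n z^n$, and let $\mathcal{S}\subset\mathcal{A}$ be the subclass of functions univalent (injective) in $\mathcal{U}$. Every $f\in\mathcal{S}$ has an inverse $f^{-1}$ satisfying $f^{-1}(f(z))=z$ for $z\in\mathcal{U}$ and $f(f^{-1}(w))=w$ for $|w|<r_0(f)$, where $r_0(f)\geq 1/4$. A function $f\in\mathcal{A}$ is bi-univalent in $\mathcal{U}$ if both $f$ and $f^{-1}$ are univalent in $\mathcal{U}$ (that is, $f$ is univalent in $\mathcal{U}$ and $f^{-1}$, defined near $0$, has an analytic continuation to $\mathcal{U}$, still denoted $f^{-1}$, which is univalent in $\mathcal{U}$); $\sigma$ denotes the class of bi-univalent functions. The class of convex functions is $\mathcal{K}=\{f\in\mathcal{S}:\Re(1+zf''(z)/f'(z))>0 \text{ for all } z\in\mathcal{U}\}$. A function $f\in\sigma$ belongs to $\mathcal{K}_{\sigma}$ (bi-convex) if both $f$ and its inverse $f^{-1}$ are convex in $\mathcal{U}$. *)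

(* Defs.v *)
From Stdlib Require Import Reals.
From Coquelicot Require Export Coquelicot.
Local Open Scope C_scope.

Definition unit_disc (z : C) : Prop := (Cmod z < 1)%R.

Definition analytic_in_disc (f : C -> C) : Prop :=
  forall z : C, unit_disc z ->
    ex_derive (K := C_AbsRing) (V := C_NormedModule) f z.

Definition univalent_in_disc (f : C -> C) : Prop :=
  analytic_in_disc f /\
  forall z1 z2 : C, unit_disc z1 -> unit_disc z2 -> f z1 = f z2 -> z1 = z2.

(* f z = z + sum_(n >= 2) a_n z^n on the disc; a_0 and a_1 are unused. *)
Definition normalized_expansion (f : C -> C) (a : nat -> C) : Prop :=
  forall z : C, unit_disc z ->
    is_series (K := C_AbsRing) (V := C_NormedModule)
      (fun k : nat => a (k + 2)%nat * z ^ (k + 2)) (f z - z).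

Definition class_A (f : C -> C) : Prop :=
  analytic_in_disc f /\ exists a : nat -> C, normalized_expansion f a.

Definition class_S (f : C -> C) : Prop :=
  class_A f /\ univalent_in_disc f.

(* g is the analytic continuation to the disc of the inverse of f|disc:
   near 0 it is a local section of f with values in the disc, so for f
   injective on the disc it agrees there with the inverse, and by the
   identity theorem g is unique on the disc.  Outside the disc the total
   function g is arbitrary. *)
Definition inverse_continuation (f g : C -> C) : Prop :=
  analytic_in_disc g /\
  exists r : R, (0 < r)%R /\
    forall w : C, (Cmod w < r)%R -> unit_disc (g w) /\ f (g w) = w.

Definition bi_univalent (f : C -> C) : Prop :=
  class_A f /\ univalent_in_disc f /\
  exists g : C -> C, inverse_continuation f g /\ univalent_in_disc g.

(* [C_derive] is Coquelicot's limit along the real direction; it is the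
   complex derivative of f and of f' here, f being holomorphic on the disc
   ([C_derive_correct]).
   A univalent f has non-vanishing derivative, so the convention x / 0 = 0
   plays no role here. *)
Definition convex_class (f : C -> C) : Prop :=
  class_S f /\
  forall z : C, unit_disc z ->
    (0 < Re (1 + z * C_derive (C_derive f) z / C_derive f z))%R.

Definition bi_convex (f : C -> C) : Prop :=
  bi_univalent f /\ convex_class f /\
  exists g : C -> C, inverse_continuation f g /\ convex_class g.

(* Main.v *)
(** For convex [f] the function p = 1 + z f''/f' = 1 + c1 z + c2 z^2 + c3 z^3 + ... has nonnegative real part on
    the disc, and

      144 (a2 a4 - a3^2) = 6 c1 c3 - (3/2) c1^4 - 3 c1^2 d - 4 d^2,   d = c2 - c1^2 / 2.

    Caratheodory's inequalities |c3| <= 2 and |d| <= 2 - |c1|^2 / 2 bound the right-hand side by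
    16 + 12 x - 2 x^2 + x^4 with x = |c1| <= 2, hence by 48.

    Those inequalities come from integrating Re p against nonnegative trigonometric polynomials on the circles
    |z| = r.  The moments are computed from the fact that the mean of a holomorphic function over |z| = r does
    not depend on r: differentiation in r produces, up to the factor 1/(i r), a total derivative in the angle. *)

Require Import Defs.
From Stdlib Require Import Reals Lra Lia.
From Coquelicot Require Import Coquelicot.
Local Open Scope R_scope.

(** * Complex derivatives and power series *)

Notation is_Cderive f z l :=
  (is_derive (K := C_AbsRing) (V := C_NormedModule) f z%C l%C).

Notation is_Cseries b l :=
  (is_series (K := C_AbsRing) (V := C_NormedModule) b l%C).

Lemma is_Cderive_eps (f : C -> C) (z l : C) :
  is_Cderive f z l <->
  forall eps : posreal, exists d : posreal, forall w : C, Cmod (w - z) < d ->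
    Cmod (f w - f z - (w - z) * l) <= eps * Cmod (w - z).
Proof.
split.
- intros [_ H] eps.
  destruct (H z (fun P HP => HP) eps) as [d Hd].
  exists d; intros w Hw.
  exact (Hd w Hw).
- intros H; split.
  + apply (is_linear_scal_l (K := C_AbsRing) (V := C_NormedModule)).
  + intros y Hy.
    assert (E : z = y) by exact (is_filter_lim_locally_unique (K := C_AbsRing) (V := AbsRing_NormedModule C_AbsRing) z y Hy).
    subst y.
    intros eps; destruct (H eps) as [d Hd]; exists d; intros w Hw; exact (Hd w Hw).
Qed.

(* Coquelicot equips C, as a module over itself, with two normed module structures that are not convertible. *)
Lemma is_Cderive_AbsRing (f : C -> C) (z l : C) :
  is_derive (K := C_AbsRing) (V := AbsRing_NormedModule C_AbsRing) f z l <->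
  is_Cderive f z l.
Proof.
split; intros [_ H]; split.
- apply (is_linear_scal_l (K := C_AbsRing) (V := C_NormedModule)).
- exact H.
- apply (is_linear_scal_l (K := C_AbsRing) (V := AbsRing_NormedModule C_AbsRing)).
- exact H.
Qed.

(** A second-order remainder bound gives differentiability, because close to [z] the factor
    [K * Cmod (w - z)] drops below any [eps]. Reciprocals and sums of power series are
    differentiated through it. *)
Lemma is_Cderive_quadratic (f : C -> C) (z l : C) (K d : R) :
  0 < d ->
  (forall w : C, Cmod (w - z) < d ->
     Cmod (f w - f z - (w - z) * l) <= K * Cmod (w - z) ^ 2) ->
  is_Cderive f z l.
Proof.
intros Hd H; apply is_Cderive_eps; intros eps.
assert (HK : 0 < Rabs K + 1) by (pose proof (Rabs_pos K); lra).
assert (Hm : 0 < Rmin d (eps / (Rabs K + 1))).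
{ apply Rmin_pos; [lra | apply Rdiv_lt_0_compat; [apply cond_pos | lra]]. }
exists (mkposreal _ Hm); simpl; intros w Hw.
pose proof (Rmin_l d (eps / (Rabs K + 1))).
pose proof (Rmin_r d (eps / (Rabs K + 1))).
eapply Rle_trans; [apply H; lra|].
pose proof (Cmod_ge_0 (w - z)).
assert (Cmod (w - z) * (Rabs K + 1) <= eps).
{ apply Rle_div_r; lra. }
pose proof (Rle_abs K).
simpl; rewrite Rmult_1_r, <- Rmult_assoc.
apply Rmult_le_compat_r; [assumption|]. nra.
Qed.

(** Neighbourhoods for the derivative come from [Cmod], those of [C_UniformSpace] from the product
    of two real lines; [locally_C] identifies them. *)
Lemma is_Cderive_continuous (f : C -> C) (z l : C) :
  is_Cderive f z l -> continuous (T := C_UniformSpace) (U := C_UniformSpace) f z.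
Proof.
intros H P HP; apply locally_C.
exact (ex_derive_continuous (K := C_AbsRing) (V := C_NormedModule) f z
  (ex_intro _ l H) P HP).
Qed.

Lemma is_Cderive_mult (f g : C -> C) (z lf lg : C) :
  is_Cderive f z lf -> is_Cderive g z lg ->
  is_Cderive (fun w => f w * g w)%C z (lf * g z + f z * lg).
Proof.
intros Hf Hg.
apply is_Cderive_AbsRing.
apply is_Cderive_AbsRing in Hf; apply is_Cderive_AbsRing in Hg.
exact (is_derive_mult (K := C_AbsRing) f g z lf lg Hf Hg Cmult_comm).
Qed.

Lemma is_Cderive_inv (g : C -> C) (z lg : C) :
  is_Cderive g z lg -> g z <> 0%C ->
  is_Cderive (fun w => / g w)%C z (- lg / (g z * g z)).
Proof.
intros Hg Hz.
assert (H : is_Cderive (fun w => / w)%C (g z) (- / (g z * g z))).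
{ apply Cmod_gt_0 in Hz as Hz'.
  (* The remainder of 1/w at g(z) is (w - g(z))^2 / (w g(z)^2). Within |g(z)|/2 of g(z) one has |w|
     >= |g(z)|/2, whence the constant 2/|g(z)|^3. *)
  apply (is_Cderive_quadratic _ _ _ (2 / Cmod (g z) ^ 3) (Cmod (g z) / 2)); [lra|].
  intros w Hw.
  assert (Hw' : Cmod (g z) / 2 <= Cmod w).
  { pose proof (Cmod_triangle w (-(w - g z))) as T.
    rewrite Cmod_opp in T.
    replace (w + - (w - g z))%C with (g z) in T by ring. lra. }
  assert (Hw0 : w <> 0%C) by (apply Cmod_gt_0; lra).
  replace (/ w - / g z - (w - g z) * - / (g z * g z))%C
    with ((w - g z) ^ 2 / (w * g z ^ 2))%C by (field; auto).
  rewrite Cmod_div, Cmod_mult, !Cmod_pow.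
  2:{ apply Cmult_neq_0; [auto | apply Cpow_nz; auto]. }
  unfold Rdiv; rewrite (Rmult_comm (2 * _)).
  apply Rmult_le_compat_l; [apply pow2_ge_0|].
  replace (2 * / Cmod (g z) ^ 3) with (/ (Cmod (g z) / 2 * Cmod (g z) ^ 2))
    by (field; lra).
  apply Rinv_le_contravar.
  - apply Rmult_lt_0_compat; [lra | apply pow_lt; lra].
  - apply Rmult_le_compat_r; [apply pow2_ge_0 | lra]. }
apply is_Cderive_AbsRing in Hg.
pose proof (is_derive_comp (K := C_AbsRing) (V := C_NormedModule) _ g z _ _ H Hg) as D.
replace (- lg / (g z * g z))%C with (scal lg (- / (g z * g z))%C : C); [exact D|].
change (lg * - / (g z * g z) = - lg / (g z * g z))%C. field; auto.
Qed.

(** * Power series on the unit disc *)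

(** Summing the two components separately gives a total function of [z]; under [disc_coefs b] it is
    the complex sum on the disc, by [is_Cseries_disc]. *)
Definition Cpseries (b : nat -> C) (z : C) : C :=
  (Series (fun n => Re (b n * z ^ n)%C), Series (fun n => Im (b n * z ^ n)%C)).

Lemma is_Cseries_ReIm (u : nat -> C) (l : C) :
  is_Cseries u l ->
  is_series (fun n => Re (u n)) (Re l) /\ is_series (fun n => Im (u n)) (Im l).
Proof.
intros H; split.
- apply (filterlim_ext (fun n => Re (sum_n (G := C_NormedModule) u n))).
  { intros n; induction n as [|n IH]; [now rewrite !sum_O|].
    rewrite !sum_Sn, <- IH. reflexivity. }
  eapply filterlim_comp; [exact H|].
  exact (continuous_fst (U := R_UniformSpace) (V := R_UniformSpace) (fst l) (snd l)).
- apply (filterlim_ext (fun n => Im (sum_n (G := C_NormedModule) u n))).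
  { intros n; induction n as [|n IH]; [now rewrite !sum_O|].
    rewrite !sum_Sn, <- IH. reflexivity. }
  eapply filterlim_comp; [exact H|].
  exact (continuous_snd (U := R_UniformSpace) (V := R_UniformSpace) (fst l) (snd l)).
Qed.

Lemma is_Cseries_Cpseries (b : nat -> C) (z l : C) :
  is_Cseries (fun n => b n * z ^ n)%C l -> Cpseries b z = l.
Proof.
intros H; apply is_Cseries_ReIm in H as [H1 H2].
unfold Cpseries; rewrite (is_series_unique _ _ H1), (is_series_unique _ _ H2).
symmetry; apply surjective_pairing.
Qed.

Lemma is_Cseries_bound (u : nat -> C) (v : nat -> R) (l : C) (B : R) :
  is_Cseries u l -> is_series v B -> (forall n, Cmod (u n) <= v n) -> Cmod l <= B.
Proof.
intros Hu Hv H.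
assert (L1 : is_lim_seq (fun n => Cmod (sum_n (G := C_NormedModule) u n)) (Cmod l)).
{ eapply filterlim_comp; [exact Hu|].
  exact (filterlim_norm (K := C_AbsRing) (V := C_NormedModule) l). }
assert (L2 : is_lim_seq (sum_n v) B) by exact Hv.
refine (is_lim_seq_le _ _ (Cmod l) B _ L1 L2).
intros n; induction n as [|n IH]; [now rewrite !sum_O|].
rewrite !sum_Sn.
eapply Rle_trans; [apply Cmod_triangle|].
apply Rplus_le_compat; [exact IH | apply H].
Qed.

(** Absolute convergence at every radius below 1, equivalent to a radius of convergence of at least
    1 by [disc_coefs_CV_radius]. *)
Definition disc_coefs (b : nat -> C) : Prop :=
  forall x : R, 0 <= x < 1 -> ex_series (fun n => Cmod (b n) * x ^ n).

(** If the radius of convergence c were below 1, the terms at (c + 1) / 2 would tend to 0 although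
    this point lies outside the disc of convergence. *)
Lemma CV_radius_Cmod_ge_1 (b : nat -> C) :
  (forall x, 0 <= x < 1 -> is_lim_seq (fun n => Cmod (b n) * x ^ n) 0) ->
  Rbar_le 1 (CV_radius (fun n => Cmod (b n))).
Proof.
intros H.
destruct (Rbar_le_lt_dec 1 (CV_radius (fun n => Cmod (b n)))) as [|L]; [assumption|].
exfalso.
assert (P : Rbar_le 0 (CV_radius (fun n => Cmod (b n)))) by apply CV_radius_ge_0.
destruct (CV_radius (fun n => Cmod (b n))) as [c| |] eqn:E; simpl in *; try tauto.
apply (CV_disk_outside (fun n => Cmod (b n)) ((c + 1) / 2)).
- rewrite E; simpl. rewrite Rabs_pos_eq; lra.
- apply H; lra.
Qed.

Lemma disc_coefs_CV_radius (b : nat -> C) :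
  disc_coefs b <-> Rbar_le 1 (CV_radius (fun n => Cmod (b n))).
Proof.
split.
- intros H; apply CV_radius_Cmod_ge_1; intros x Hx.
  exact (ex_series_lim_0 _ (H x Hx)).
- intros H x Hx.
  eapply ex_series_ext; [|apply (CV_disk_inside (fun n => Cmod (b n)) x)].
  + intros n; simpl. rewrite Rabs_pos_eq; [reflexivity|].
    apply Rmult_le_pos; [apply Cmod_ge_0 | apply pow_le; lra].
  + eapply Rbar_lt_le_trans; [|exact H]. simpl. rewrite Rabs_pos_eq; lra.
Qed.

Definition Cps_derive (b : nat -> C) (n : nat) : C := (INR (S n) * b (S n))%C.

Lemma disc_coefs_derive (b : nat -> C) : disc_coefs b -> disc_coefs (Cps_derive b).
Proof.
rewrite !disc_coefs_CV_radius; intros H.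
rewrite <- CV_radius_derive in H.
erewrite CV_radius_ext; [exact H|].
intros n; unfold Cps_derive, PS_derive.
rewrite Cmod_mult, Cmod_R, Rabs_pos_eq; [reflexivity | apply pos_INR].
Qed.

(** At a point of [0, 1), convergence makes the real and imaginary parts of the terms tend to 0,
    hence their moduli, and [CV_radius_Cmod_ge_1] applies. *)
Lemma disc_coefs_of_convergent (b : nat -> C) :
  (forall z : C, unit_disc z -> exists l, is_Cseries (fun n => b n * z ^ n)%C l) ->
  disc_coefs b.
Proof.
intros H; apply disc_coefs_CV_radius, CV_radius_Cmod_ge_1; intros x Hx.
destruct (H (RtoC x)) as [l Hl].
{ unfold unit_disc; rewrite Cmod_R, Rabs_pos_eq; lra. }
apply is_Cseries_ReIm in Hl as [H1 H2].
assert (L1 : is_lim_seq _ 0) by exact (ex_series_lim_0 _ (ex_intro _ _ H1)).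
assert (L2 : is_lim_seq _ 0) by exact (ex_series_lim_0 _ (ex_intro _ _ H2)).
apply is_lim_seq_abs_0 in L1; apply is_lim_seq_abs_0 in L2.
pose proof (is_lim_seq_plus' _ _ _ _ L1 L2) as L; rewrite Rplus_0_l in L.
refine (is_lim_seq_le_le (fun _ => 0) _ _ 0 _ (is_lim_seq_const 0) L).
intros n; split.
- apply Rmult_le_pos; [apply Cmod_ge_0 | apply pow_le; lra].
- rewrite <- (Rabs_pos_eq (x ^ n)), <- Cmod_R, RtoC_pow, <- Cmod_mult
    by (apply pow_le; lra).
  set (c := (b n * RtoC x ^ n)%C).
  replace c with (Re c + Ci * Im c)%C at 1.
  + eapply Rle_trans; [apply Cmod_triangle|].
    rewrite Cmod_mult, Cmod_Ci, !Cmod_R; lra.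
  + unfold c; apply injective_projections; simpl; unfold Re, Im; ring.
Qed.

Lemma is_Cseries_disc (b : nat -> C) (z : C) :
  disc_coefs b -> unit_disc z -> is_Cseries (fun n => b n * z ^ n)%C (Cpseries b z).
Proof.
intros Hb Hz.
assert (X : ex_series (K := C_AbsRing) (V := C_NormedModule) (fun n => b n * z ^ n)%C).
{ apply (ex_series_le (K := C_AbsRing) (V := C_CompleteNormedModule) _ (fun n => Cmod (b n) * Cmod z ^ n)).
  - intros n. change (Cmod (b n * z ^ n) <= Cmod (b n) * Cmod z ^ n).
    rewrite Cmod_mult, Cmod_pow; lra.
  - apply Hb; split; [apply Cmod_ge_0 | exact Hz]. }
destruct X as [l Hl]. rewrite (is_Cseries_Cpseries _ _ _ Hl). exact Hl.
Qed.

(** The factor (n + 1)(n + 2) x^n is that of a second derivative: weighted by the moduli of the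
    coefficients, these bounds sum to the series of [Cps_derive (Cps_derive b)] at [x]. *)
Lemma Cpow_taylor2 (z w : C) (x : R) (n : nat) :
  Cmod z <= x -> Cmod w <= x ->
  Cmod (w ^ (n + 2) - z ^ (n + 2) - (w - z) * (INR (n + 2) * z ^ (n + 1))) <=
  INR (n + 1) * INR (n + 2) * x ^ n * Cmod (w - z) ^ 2.
Proof.
intros Hz Hw.
assert (Hx : 0 <= x) by (pose proof (Cmod_ge_0 z); lra).
induction n as [|n IH].
- simpl plus. replace (_ - _)%C with ((w - z) ^ 2)%C.
  + rewrite Cmod_pow. simpl. pose proof (pow2_ge_0 (Cmod (w - z))). nra.
  + simpl. rewrite RtoC_plus. ring.
(* With R_n the remainder for exponent n + 2, R_(n+1) = (n + 2) z^(n+1) (w - z)^2 + w R_n. *)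
- replace (w ^ (S n + 2) - z ^ (S n + 2) - (w - z) * (INR (S n + 2) * z ^ (S n + 1)))%C
    with (INR (n + 2) * (z ^ (n + 1) * (w - z) ^ 2) +
          w * (w ^ (n + 2) - z ^ (n + 2) - (w - z) * (INR (n + 2) * z ^ (n + 1))))%C.
  2:{ replace (S n + 2)%nat with (S (n + 2)) by lia.
      replace (S n + 1)%nat with (S (n + 1)) by lia.
      rewrite S_INR, RtoC_plus.
      replace (z ^ (n + 2))%C with (z * z ^ (n + 1))%C
        by (rewrite <- Cpow_S; f_equal; lia).
      rewrite !Cpow_S. replace (z ^ (n + 2))%C with (z * z ^ (n + 1))%C
        by (rewrite <- Cpow_S; f_equal; lia).
      simpl (_ ^ 2)%C. ring. }
  eapply Rle_trans; [apply Cmod_triangle|].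
  rewrite !Cmod_mult, !Cmod_pow, Cmod_R, (Rabs_pos_eq _ (pos_INR _)).
  replace (S n + 2)%nat with (S (n + 2)) by lia.
  replace (S n + 1)%nat with (n + 2)%nat by lia.
  set (h := Cmod (w - z) ^ 2) in *.
  set (e := Cmod (_ - _ - _)) in *.
  assert (Hh : 0 <= h) by apply pow2_ge_0.
  assert (He : 0 <= e) by apply Cmod_ge_0.
  assert (P1 : Cmod z ^ (n + 1) <= x ^ S n).
  { replace (n + 1)%nat with (S n) by lia.
    apply pow_incr; split; [apply Cmod_ge_0 | assumption]. }
  assert (P2 : INR (n + 2) * (Cmod z ^ (n + 1) * h) <= INR (n + 2) * (x ^ S n * h)).
  { apply Rmult_le_compat_l; [apply pos_INR|].
    apply Rmult_le_compat_r; assumption. }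
  assert (P3 : Cmod w * e <= x * (INR (n + 1) * INR (n + 2) * x ^ n * h)).
  { apply Rmult_le_compat; auto. apply Cmod_ge_0. }
  apply Rle_trans with (1 := Rplus_le_compat _ _ _ _ P2 P3).
  rewrite (S_INR (n + 2)), !plus_INR; simpl (x ^ S n).
  assert (0 <= x * x ^ n * h)
    by (apply Rmult_le_pos; [apply Rmult_le_pos; [auto | apply pow_le; auto] | exact Hh]).
  simpl INR. pose proof (pos_INR n).
  assert (0 <= INR n * (x * x ^ n * h)) by (apply Rmult_le_pos; auto).
  nra.
Qed.

(** The remainders of the monomials, bounded by [Cpow_taylor2], sum to at most a constant times |w -
    z|^2. *)
Lemma is_Cderive_Cpseries (b : nat -> C) (z : C) :
  disc_coefs b -> unit_disc z ->
  is_Cderive (Cpseries b) z (Cpseries (Cps_derive b) z).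
Proof.
intros Hb Hz; unfold unit_disc in Hz.
pose proof (Cmod_ge_0 z) as Hz0.
(* A radius halfway between |z| and 1: every [w] within [x - Cmod z] of [z] has modulus at most
   [x]. *)
set (x := (1 + Cmod z) / 2).
assert (Hx : 0 <= x < 1) by (unfold x; lra).
pose proof (disc_coefs_derive _ Hb) as Hb1.
destruct (disc_coefs_derive _ Hb1 x Hx) as [K HK].
apply (is_Cderive_quadratic _ _ _ K (x - Cmod z)); [unfold x; lra|].
intros w Hw.
assert (Hwx : Cmod w <= x).
{ pose proof (Cmod_triangle (w - z) z) as T.
  replace (w - z + z)%C with w in T by ring. lra. }
assert (Hw1 : unit_disc w) by (unfold unit_disc; lra).
pose proof (is_Cseries_disc _ _ Hb Hw1) as Sw.
pose proof (is_Cseries_disc _ _ Hb Hz) as Sz.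
pose proof (is_Cseries_disc _ _ Hb1 Hz) as S1.
pose proof (is_series_minus _ _ _ _ Sw Sz) as D.
change (is_Cseries (fun n => b n * w ^ n - b n * z ^ n)%C (Cpseries b w - Cpseries b z)) in D.
(* The constant terms cancel; dropping index 0 aligns the difference with the shifted coefficients
   of [Cps_derive b]. *)
assert (D1 : is_Cseries (fun n => b (S n) * w ^ S n - b (S n) * z ^ S n)%C
               (Cpseries b w - Cpseries b z)).
{ apply (is_series_incr_1 (K := C_AbsRing) (V := C_NormedModule)
    (fun n => b n * w ^ n - b n * z ^ n)%C).
  match goal with |- is_series _ ?l =>
    replace l with (Cpseries b w - Cpseries b z)%C; [exact D|] end.
  change (Cpseries b w - Cpseries b z =
    Cpseries b w - Cpseries b z + (b 0%nat * w ^ 0 - b 0%nat * z ^ 0))%C.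
  simpl; ring. }
pose proof (is_series_minus _ _ _ _ D1
  (is_series_scal (K := C_AbsRing) (V := C_NormedModule) (w - z)%C _ _ S1)) as E.
(* The linear term leaves no remainder, so a second shift starts the sum at exponent 2. *)
assert (E1 := is_series_incr_1 (K := C_AbsRing) (V := C_NormedModule)
  (fun n => b (S n) * w ^ S n - b (S n) * z ^ S n - (w - z) * (Cps_derive b n * z ^ n))%C
  (Cpseries b w - Cpseries b z - (w - z) * Cpseries (Cps_derive b) z)%C).
refine (is_Cseries_bound _ _ _ _ (E1 _) (is_series_scal_r (Cmod (w - z) ^ 2) _ _ HK) _).
- match goal with |- is_series _ ?l =>
    replace l with (Cpseries b w - Cpseries b z - (w - z) * Cpseries (Cps_derive b) z)%C;
    [exact E|] end.
  set (A := (_ - _ - _)%C).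
  change (A = A + (b 1%nat * w ^ 1 - b 1%nat * z ^ 1 - (w - z) * (Cps_derive b 0 * z ^ 0)))%C.
  unfold Cps_derive; simpl. ring.
- intros n; unfold Cps_derive.
  replace (_ - _)%C with (b (n + 2)%nat *
    (w ^ (n + 2) - z ^ (n + 2) - (w - z) * (INR (n + 2) * z ^ (n + 1))))%C.
  2:{ replace (n + 2)%nat with (S (S n)) by lia.
      replace (n + 1)%nat with (S n) by lia. ring. }
  replace (S (S n)) with (n + 2)%nat by lia.
  replace (S n) with (n + 1)%nat by lia.
  rewrite !Cmod_mult, !Cmod_R, !(Rabs_pos_eq _ (pos_INR _)).
  replace (_ * _ * Cmod (w - z) ^ 2) with (Cmod (b (n + 2)%nat) *
    (INR (n + 1) * INR (n + 2) * x ^ n * Cmod (w - z) ^ 2)) by ring.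
  apply Rmult_le_compat_l; [apply Cmod_ge_0|].
  apply Cpow_taylor2; unfold x in *; lra.
Qed.

Lemma Cpseries_incr (b : nat -> C) (z : C) :
  disc_coefs b -> unit_disc z ->
  disc_coefs (fun n => b (S n)) /\
  Cpseries b z = (b 0%nat + z * Cpseries (fun n => b (S n)) z)%C.
Proof.
intros Hb Hz.
assert (H : disc_coefs (fun n => b (S n))).
{ apply disc_coefs_CV_radius.
  change (Rbar_le 1 (CV_radius (PS_decr_1 (fun n => Cmod (b n))))).
  rewrite CV_radius_decr_1. apply disc_coefs_CV_radius; assumption. }
split; [exact H|].
apply is_Cseries_Cpseries.
apply is_series_decr_1.
match goal with |- is_series _ ?l =>
  replace l with (z * Cpseries (fun n => b (S n)) z)%C end.
- apply (is_series_ext (K := C_AbsRing) (V := C_NormedModule)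
    (fun n => z * (b (S n) * z ^ n))%C).
  + intros n; change (z * (b (S n) * z ^ n) = b (S n) * (z * z ^ n))%C; ring.
  + exact (is_series_scal (K := C_AbsRing) (V := C_NormedModule) z _ _ (is_Cseries_disc _ _ H Hz)).
- change (@eq C (z * Cpseries (fun n => b (S n)) z)
    (b 0%nat + z * Cpseries (fun n => b (S n)) z + - (b 0%nat * 1)))%C.
  ring.
Qed.

(** * Means over circles *)

(** The real differential of Re phi at the point is d |-> Re (l d); the chain rule in two real
    variables does the rest. *)
Lemma is_derive_Re_curve (phi : C -> C) (g1 g2 : R -> R) (t d1 d2 : R) (l : C) :
  is_Cderive phi (g1 t, g2 t) l -> is_derive g1 t d1 -> is_derive g2 t d2 ->
  is_derive (fun s => Re (phi (g1 s, g2 s))) t (Re (l * (d1, d2))%C).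
Proof.
intros Hphi H1 H2.
assert (F : filterdiff (U := prod_NormedModule R_AbsRing R_NormedModule R_NormedModule)
  (fun c : R * R => Re (phi (fst c, snd c))) (locally (g1 t, g2 t))
  (fun d : R * R => Re (l * (fst d, snd d))%C)).
{ split.
  - split.
    + intros x y.
      change (Re (l * ((fst x + fst y)%R, (snd x + snd y)%R))%C =
        Re (l * (fst x, snd x))%C + Re (l * (fst y, snd y))%C).
      rewrite !re_mult; simpl; ring.
    + intros k x.
      change (Re (l * ((k * fst x)%R, (k * snd x)%R))%C = k * Re (l * (fst x, snd x))%C).
      rewrite !re_mult; simpl; ring.
    (* The added 1 keeps the operator bound positive when l = 0. *)
    + exists (Cmod l + 1); split; [pose proof (Cmod_ge_0 l); lra|].
      intros [x1 x2].
      assert (N := Cmod_norm (x1, x2)); unfold R_NormedModule in N; simpl in N.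
      match goal with |- _ <= _ * ?n => replace n with (Cmod (x1, x2)) by exact N end.
      change (Rabs (Re (l * (x1, x2))%C) <= (Cmod l + 1) * Cmod (x1, x2)).
      eapply Rle_trans; [apply re_le_Cmod|]. rewrite Cmod_mult.
      apply Rmult_le_compat_r; [apply Cmod_ge_0 | lra].
  - intros x Hx.
    assert (E : (g1 t, g2 t) = x) by exact (is_filter_lim_locally_unique
      (V := prod_NormedModule R_AbsRing R_NormedModule R_NormedModule) _ _ Hx).
    subst x.
    intros eps. apply locally_C.
    destruct (proj1 (is_Cderive_eps _ _ _) Hphi eps) as [d Hd].
    exists d; intros [w1 w2] Hw.
    match goal with |- _ <= _ * ?n =>
      replace n with (Cmod ((w1, w2) - (g1 t, g2 t))) by (apply Cmod_norm) end.
    eapply Rle_trans; [|exact (Hd (w1, w2) Hw)].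
    eapply Rle_trans; [|apply re_le_Cmod].
    apply Req_le, (f_equal Rabs).
    change (Re (phi (w1, w2)) + - Re (phi (g1 t, g2 t)) +
      - Re (l * ((w1 + - g1 t)%R, (w2 + - g2 t)%R))%C =
      Re (phi (w1, w2) - phi (g1 t, g2 t) - ((w1, w2) - (g1 t, g2 t)) * l)%C).
    unfold Cminus; rewrite !re_plus, !re_opp, !re_mult; simpl; ring. }
pose proof (filterdiff_comp'_2 (U := R_NormedModule) (V := R_NormedModule) (W := R_NormedModule)
  g1 g2 (fun a b => Re (phi (a, b))) t _ _ (fun a b => Re (l * (a, b))%C) H1 H2 F) as D.
apply (filterdiff_ext_lin _ _ _ D).
intros y; change (Re (l * ((y * d1)%R, (y * d2)%R))%C = y * Re (l * (d1, d2))%C).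
rewrite !re_mult; simpl; ring.
Qed.

Lemma continuous_Re_curve {T : UniformSpace} (phi : C -> C) (g1 g2 : T -> R) (x : T) :
  continuous (T := C_UniformSpace) (U := C_UniformSpace) phi (g1 x, g2 x) ->
  continuous g1 x -> continuous g2 x -> continuous (fun y => Re (phi (g1 y, g2 y))) x.
Proof.
intros H H1 H2.
apply (continuous_comp_2 g1 g2 (fun a b => Re (phi (a, b))) x H1 H2).
apply (continuous_ext (fun c : R * R => Re (phi c))).
{ now intros [a b]. }
apply (continuous_comp (U := prod_UniformSpace R_UniformSpace R_UniformSpace) phi fst); [exact H|].
rewrite (surjective_pairing (phi _)). apply continuous_fst.
Qed.

Notation Ccontinuous f z :=
  (continuous (T := C_UniformSpace) (U := C_UniformSpace) f z%C).

(** The derivative is an explicit argument; its continuity allows integrating it over circles and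
    differentiating under the integral sign. *)
Definition C1_on (U : C -> Prop) (phi dphi : C -> C) : Prop :=
  forall z, U z -> is_Cderive phi z (dphi z) /\ Ccontinuous dphi z.

Definition punctured_disc (z : C) : Prop := 0 < Cmod z < 1.

Definition polar (r t : R) : C := (r * cos t, r * sin t).

Definition circle_mean (phi : C -> C) (r : R) : R :=
  RInt (fun t => Re (phi (polar r t))) 0 (2 * PI) / (2 * PI).

Lemma Cmod_polar (r t : R) : Cmod (polar r t) = Rabs r.
Proof.
unfold Cmod, polar; simpl.
rewrite <- (sqrt_Rsqr_abs r); f_equal; unfold Rsqr.
pose proof (sin2_cos2 t); unfold Rsqr in *; nra.
Qed.

Lemma punctured_polar (r t : R) : 0 < r < 1 -> punctured_disc (polar r t).
Proof.
intros H; unfold punctured_disc; rewrite Cmod_polar, Rabs_pos_eq; lra.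
Qed.

Lemma Ccontinuous_mult (f g : C -> C) (z : C) :
  Ccontinuous f z -> Ccontinuous g z -> Ccontinuous (fun w => f w * g w)%C z.
Proof.
intros Hf Hg P HP; apply locally_C in HP.
refine (continuous_mult (U := C_UniformSpace) (K := C_AbsRing) f g z _ _ P HP);
  intros Q HQ; apply locally_C in HQ; auto.
Qed.

Lemma C1_on_mult (U : C -> Prop) (f g df dg : C -> C) :
  C1_on U f df -> C1_on U g dg ->
  C1_on U (fun z => f z * g z)%C (fun z => df z * g z + f z * dg z)%C.
Proof.
intros Hf Hg z Hz; destruct (Hf z Hz) as [F1 F2], (Hg z Hz) as [G1 G2]; split.
- now apply is_Cderive_mult.
- apply (continuous_plus (U := C_UniformSpace) (V := C_NormedModule));
    apply Ccontinuous_mult; auto; eapply is_Cderive_continuous; eassumption.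
Qed.

Lemma C1_on_const (U : C -> Prop) (c : C) : C1_on U (fun _ => c) (fun _ => 0%C).
Proof.
intros z _; split.
- exact (is_derive_const (K := C_AbsRing) (V := C_NormedModule) c z).
- apply continuous_const.
Qed.

Lemma C1_on_id (U : C -> Prop) : C1_on U (fun z => z) (fun _ => 1%C).
Proof.
intros z _; split.
- apply is_Cderive_AbsRing; exact (is_derive_id (K := C_AbsRing) z).
- apply continuous_const.
Qed.

Lemma C1_on_plus (U : C -> Prop) (f g df dg : C -> C) :
  C1_on U f df -> C1_on U g dg ->
  C1_on U (fun z => f z + g z)%C (fun z => df z + dg z)%C.
Proof.
intros Hf Hg z Hz; destruct (Hf z Hz) as [F1 F2], (Hg z Hz) as [G1 G2]; split.
- exact (is_derive_plus (K := C_AbsRing) (V := C_NormedModule) _ _ _ _ _ F1 G1).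
- exact (continuous_plus (U := C_UniformSpace) (V := C_NormedModule) _ _ _ F2 G2).
Qed.

Lemma C1_on_inv (U : C -> Prop) (g dg : C -> C) :
  C1_on U g dg -> (forall z, U z -> g z <> 0%C) ->
  C1_on U (fun z => / g z)%C (fun z => (-1 * dg z) * (/ g z * / g z))%C.
Proof.
intros Hg H0 z Hz; destruct (Hg z Hz) as [G1 G2].
pose proof (is_Cderive_inv _ _ _ G1 (H0 z Hz)) as D.
assert (D0 : Ccontinuous (fun w => / g w)%C z)
  by (eapply is_Cderive_continuous; eassumption).
split.
- replace (-1 * dg z * (/ g z * / g z))%C with (- dg z / (g z * g z))%C; [exact D|].
  field; auto.
- apply Ccontinuous_mult; [|now apply Ccontinuous_mult].
  apply Ccontinuous_mult; [apply continuous_const | exact G2].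
Qed.

Lemma continuous_polar (phi : C -> C) (r t : R) :
  Ccontinuous phi (polar r t) -> continuous (fun s => Re (phi (polar r s))) t.
Proof.
intros H; apply (continuous_Re_curve phi (fun s => r * cos s) (fun s => r * sin s)).
- exact H.
- apply (ex_derive_continuous (K := R_AbsRing) (V := R_NormedModule)); auto_derive; auto.
- apply (ex_derive_continuous (K := R_AbsRing) (V := R_NormedModule)); auto_derive; auto.
Qed.

Lemma ex_RInt_polar (phi : C -> C) (r : R) :
  (forall t, Ccontinuous phi (polar r t)) ->
  ex_RInt (fun t => Re (phi (polar r t))) 0 (2 * PI).
Proof.
intros H; apply (ex_RInt_continuous (V := R_CompleteNormedModule)).
intros t _; apply continuous_polar, H.
Qed.

Lemma C1_on_continuous (U : C -> Prop) (phi dphi : C -> C) (z : C) :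
  C1_on U phi dphi -> U z -> Ccontinuous phi z.
Proof.
intros H Hz; eapply is_Cderive_continuous; exact (proj1 (H z Hz)).
Qed.

(* i z phi'(z) is the derivative of phi (r e^(it)) in t. *)
Lemma circle_mean_tangent (U : C -> Prop) (phi dphi : C -> C) (r : R) :
  C1_on U phi dphi -> (forall t, U (polar r t)) ->
  circle_mean (fun z => Ci * (z * dphi z))%C r = 0.
Proof.
intros H HU; unfold circle_mean.
erewrite is_RInt_unique; [apply Rdiv_0_l|].
replace 0 with (minus (Re (phi (polar r (2 * PI)))) (Re (phi (polar r 0)))) at 2.
2:{ unfold polar; rewrite cos_2PI, sin_2PI, cos_0, sin_0; exact (Rminus_diag_eq _ _ eq_refl). }
apply (is_RInt_derive (V := R_CompleteNormedModule)
  (fun t => Re (phi (polar r t))) (fun t => Re (Ci * (polar r t * dphi (polar r t)))%C)).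
- intros t _.
  replace (Ci * (polar r t * dphi (polar r t)))%C
    with (dphi (polar r t) * (- (r * sin t), r * cos t)%R)%C
    by (unfold polar; apply injective_projections; simpl; ring).
  apply (is_derive_Re_curve phi (fun t => r * cos t) (fun t => r * sin t)).
  + apply H, HU.
  + auto_derive; auto; ring.
  + auto_derive; auto; ring.
- intros t _; apply (continuous_polar (fun z => Ci * (z * dphi z))%C).
  apply Ccontinuous_mult; [apply continuous_const|].
  apply Ccontinuous_mult; [apply continuous_id | apply H, HU].
Qed.

(** Differentiation under the integral sign, (cos t, sin t) being the derivative of [polar r t] in
    [r]. *)
Lemma is_derive_circle_integral (phi dphi : C -> C) (r : R) :
  C1_on punctured_disc phi dphi -> 0 < r < 1 ->
  is_derive (fun r => RInt (fun t => Re (phi (polar r t))) 0 (2 * PI)) r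
    (RInt (fun t => Re (dphi (polar r t) * (cos t, sin t))%C) 0 (2 * PI)).
Proof.
intros H Hr.
assert (L : locally r (fun r => 0 < r < 1)).
{ apply (locally_interval _ r 0 1); simpl; try lra; intros; lra. }
assert (D : forall t s, 0 < s < 1 ->
  is_derive (fun s => Re (phi (polar s t))) s (Re (dphi (polar s t) * (cos t, sin t))%C)).
{ intros t s Hs.
  apply (is_derive_Re_curve phi (fun s => s * cos t) (fun s => s * sin t)).
  + apply H, (punctured_polar _ _ Hs).
  + auto_derive; auto; ring.
  + auto_derive; auto; ring. }
erewrite RInt_ext.
2:{ intros t _; symmetry; apply is_derive_unique, D; exact Hr. }
apply (is_derive_RInt_param (fun s t => Re (phi (polar s t)))).
- refine (filter_imp _ _ _ L); intros s Hs t _.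
  eexists; apply D; exact Hs.
- intros t _.
  apply (continuity_2d_pt_ext_loc (fun s t => Re (dphi (polar s t) * (cos t, sin t))%C)).
  { apply locally_2d_locally.
    refine (filter_imp (fun c => 0 < fst c < 1) _ _ _).
    - intros [u v] Huv; symmetry; apply is_derive_unique, D; exact Huv.
    - exact (continuous_fst (U := R_UniformSpace) (V := R_UniformSpace) r t _ L). }
  apply continuity_2d_pt_filterlim.
  assert (C1 : continuous (T := prod_UniformSpace R_UniformSpace R_UniformSpace)
      (fun c => cos (snd c)) (r, t)).
  { apply (continuous_comp (U := prod_UniformSpace R_UniformSpace R_UniformSpace) snd cos).
    - apply continuous_snd.
    - apply continuous_cos. }
  assert (S1 : continuous (T := prod_UniformSpace R_UniformSpace R_UniformSpace)
      (fun c => sin (snd c)) (r, t)).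
  { apply (continuous_comp (U := prod_UniformSpace R_UniformSpace R_UniformSpace) snd sin).
    - apply continuous_snd.
    - apply continuous_sin. }
  assert (X : forall psi : C -> C, Ccontinuous psi (polar r t) ->
     continuous (T := prod_UniformSpace R_UniformSpace R_UniformSpace)
      (fun c => Re (psi (polar (fst c) (snd c)))) (r, t)).
  { intros psi Hpsi.
    apply (continuous_Re_curve (T := prod_UniformSpace R_UniformSpace R_UniformSpace)
      psi (fun c => fst c * cos (snd c)) (fun c => fst c * sin (snd c))); [exact Hpsi| |].
    - apply (continuous_mult (K := R_AbsRing) fst (fun c => cos (snd c)));
       [apply continuous_fst | exact C1].
    - apply (continuous_mult (K := R_AbsRing) fst (fun c => sin (snd c)));
       [apply continuous_fst | exact S1]. }
  assert (Hd : Ccontinuous dphi (polar r t)) by (apply H, (punctured_polar _ _ Hr)).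
  change (continuous (T := prod_UniformSpace R_UniformSpace R_UniformSpace)
    (fun c => Re (dphi (polar (fst c) (snd c)) * (cos (snd c), sin (snd c)))%C) (r, t)).
  (* The identity Re (w e^(it)) = Re w cos t + Re (i w) sin t reduces joint continuity to that of
     real parts. *)
  apply (continuous_ext (T := prod_UniformSpace R_UniformSpace R_UniformSpace)
    (fun c => Re (dphi (polar (fst c) (snd c))) * cos (snd c)
      + Re (Ci * dphi (polar (fst c) (snd c)))%C * sin (snd c))).
  { intros c; rewrite !re_mult; simpl; ring. }
  apply (continuous_plus (V := R_NormedModule)).
  + apply (continuous_mult (K := R_AbsRing)); [apply (X dphi Hd) | exact C1].
  + apply (continuous_mult (K := R_AbsRing)); [|exact S1].
    apply (X (fun z => Ci * dphi z)%C).
    apply Ccontinuous_mult; [apply continuous_const | exact Hd].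
- refine (filter_imp _ _ _ L); intros s Hs; apply ex_RInt_polar; intros t.
  eapply C1_on_continuous; [exact H | apply (punctured_polar _ _ Hs)].
Qed.

Lemma circle_mean_const (phi dphi : C -> C) (s r : R) :
  C1_on punctured_disc phi dphi -> 0 < s < r -> r < 1 ->
  circle_mean phi s = circle_mean phi r.
Proof.
intros H Hs Hr; unfold circle_mean; f_equal.
apply (eq_is_derive (fun r => RInt (fun t => Re (phi (polar r t))) 0 (2 * PI))); [|lra].
intros x Hx.
pose proof (is_derive_circle_integral _ _ x H ltac:(lra)) as D.
enough (Z : RInt (fun t => Re (dphi (polar x t) * (cos t, sin t))%C) 0 (2 * PI) = 0)
  by (rewrite Z in D; exact D).
(* For the function -(i/x) phi, i z times its derivative is (z/x) phi'(z) = e^(it) phi'(z) on |z| =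
   x, which is the radial integrand. *)
pose proof (circle_mean_tangent _ _ _ x
  (C1_on_mult _ _ _ _ _ (C1_on_const punctured_disc (- Ci * RtoC (/ x))%C) H)
  (fun t => punctured_polar x t ltac:(lra))) as T.
unfold circle_mean in T.
assert (P := PI_RGT_0).
apply (Rmult_eq_compat_r (2 * PI)) in T.
rewrite Rmult_0_l in T; unfold Rdiv in T; rewrite Rmult_assoc, Rinv_l, Rmult_1_r in T by lra.
rewrite <- T at 2.
apply RInt_ext; intros t _; f_equal.
unfold polar; apply injective_projections; simpl; field; lra.
Qed.

(** Since the mean does not depend on the radius, it can be computed on a circle of arbitrarily
    small radius s, where [phi] is within K s of [c]. *)
Lemma circle_mean_limit (phi dphi : C -> C) (c : C) (K d r : R) :
  C1_on punctured_disc phi dphi -> 0 < d ->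
  (forall z, 0 < Cmod z < d -> Cmod (phi z - c) <= K * Cmod z) ->
  0 < r < 1 -> circle_mean phi r = Re c.
Proof.
intros H Hd HK Hr.
assert (P := PI_RGT_0).
apply Rminus_diag_uniq, Rabs_eq_0, Rle_antisym; [|apply Rabs_pos].
apply le_epsilon; intros eps Heps; rewrite Rplus_0_l.
pose proof (Rabs_pos K) as HK0. pose proof (Rle_abs K).
(* The three bounds put [s] below [d] and below [r], and make [K * s] at most [eps]. *)
set (s := Rmin (Rmin (d / 2) (r / 2)) (eps / (Rabs K + 1))).
assert (Hs : 0 < s).
{ repeat apply Rmin_pos; try lra. apply Rdiv_lt_0_compat; lra. }
assert (Hs1 : s <= d / 2 /\ s <= r / 2 /\ s <= eps / (Rabs K + 1)).
{ unfold s.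
  pose proof (Rmin_l (Rmin (d / 2) (r / 2)) (eps / (Rabs K + 1))).
  pose proof (Rmin_r (Rmin (d / 2) (r / 2)) (eps / (Rabs K + 1))).
  pose proof (Rmin_l (d / 2) (r / 2)). pose proof (Rmin_r (d / 2) (r / 2)). lra. }
destruct Hs1 as (Hs1 & Hs2 & Hs3).
rewrite <- (circle_mean_const phi dphi s r H) by lra.
unfold circle_mean.
assert (E : ex_RInt (fun t => Re (phi (polar s t))) 0 (2 * PI)).
{ apply ex_RInt_polar; intros t.
  eapply C1_on_continuous; [exact H | apply punctured_polar; lra]. }
replace (_ - Re c) with
  (RInt (fun t => Re (phi (polar s t)) - Re c) 0 (2 * PI) / (2 * PI)).
2:{ rewrite (RInt_minus (V := R_CompleteNormedModule) _ _ _ _ E (ex_RInt_const _ _ _)).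
    rewrite RInt_const.
    unfold minus, plus, opp, scal; simpl; unfold mult; simpl. field; lra. }
unfold Rdiv; rewrite Rabs_mult, (Rabs_pos_eq (/ _)).
2:{ apply Rlt_le, Rinv_0_lt_compat; lra. }
apply (Rle_div_l _ _ (2 * PI)); [lra|].
rewrite (Rmult_comm eps); rewrite <- (Rminus_0_r (2 * PI)) at 2.
apply abs_RInt_le_const; [lra| |].
- apply (ex_RInt_minus (V := R_CompleteNormedModule) _ _ _ _ E), ex_RInt_const.
- intros t _.
  replace (Re (phi (polar s t)) - Re c) with (Re (phi (polar s t) - c)%C)
    by (unfold Cminus; rewrite re_plus, re_opp; ring).
  eapply Rle_trans; [apply re_le_Cmod|].
  assert (M : Cmod (polar s t) = s) by (rewrite Cmod_polar; apply Rabs_pos_eq; lra).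
  eapply Rle_trans; [apply HK; rewrite M; lra|]. rewrite M.
  apply (Rle_div_r s eps) in Hs3; nra.
Qed.

(** The derivative is left to unification, which assembles it along the shape of the function;
    factors that are neither constant nor the identity remain as goals. *)
Ltac C1_split :=
  repeat lazymatch goal with
  | |- C1_on _ (fun _ => ?c) _ => apply C1_on_const
  | |- C1_on _ (fun z => z) _ => apply C1_on_id
  | |- C1_on _ (fun z => Cplus (@?f z) (@?g z)) _ => refine (C1_on_plus _ f g _ _ _ _)
  | |- C1_on _ (fun z => Cmult (@?f z) (@?g z)) _ => refine (C1_on_mult _ f g _ _ _ _)
  end.

Lemma C1_on_subset (U V : C -> Prop) (phi dphi : C -> C) :
  (forall z, V z -> U z) -> C1_on U phi dphi -> C1_on V phi dphi.
Proof. intros HUV H z Hz; apply H, HUV, Hz. Qed.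

Lemma locally_bounded (phi : C -> C) :
  Ccontinuous phi (RtoC 0) ->
  exists d K, 0 < d /\ forall z, Cmod z < d -> Cmod (phi z) <= K.
Proof.
intros H.
assert (B : locally (T := C_UniformSpace) (phi 0%C)
   (fun y => Cmod (y - phi 0%C) < 1)).
{ apply locally_C. exists (mkposreal 1 Rlt_0_1). intros y Hy; exact Hy. }
apply H in B. apply locally_C in B. destruct B as [d Hd].
exists d, (Cmod (phi 0%C) + 1); split; [apply cond_pos|].
intros z Hz.
assert (Hz' : Cmod (phi z - phi 0%C) < 1).
{ apply Hd. change (Cmod (z - 0) < d).
  replace (z - 0)%C with z by ring. exact Hz. }
pose proof (Cmod_triangle (phi z - phi 0%C) (phi 0%C)) as T.
replace (phi z - phi 0 + phi 0)%C with (phi z) in T by ring. lra.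
Qed.

Lemma circle_mean_plus (f g : C -> C) (r : R) :
  (forall t, Ccontinuous f (polar r t)) -> (forall t, Ccontinuous g (polar r t)) ->
  circle_mean (fun z => f z + g z)%C r = circle_mean f r + circle_mean g r.
Proof.
intros Hf Hg; unfold circle_mean.
rewrite <- Rdiv_plus_distr; f_equal.
rewrite <- (RInt_plus (V := R_CompleteNormedModule) (fun t => Re (f (polar r t))))
  by (apply ex_RInt_polar; assumption).
apply RInt_ext; intros t _; apply re_plus.
Qed.

Lemma circle_mean_ge_0 (phi : C -> C) (r : R) :
  (forall t, Ccontinuous phi (polar r t)) -> (forall t, 0 <= Re (phi (polar r t))) ->
  0 <= circle_mean phi r.
Proof.
intros Hc H; unfold circle_mean.
assert (P := PI_RGT_0).
apply Rdiv_le_0_compat; [|lra].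
apply RInt_ge_0; [lra | apply ex_RInt_polar, Hc | auto].
Qed.

Lemma circle_mean_ext (f g : C -> C) (r : R) :
  (forall t, f (polar r t) = g (polar r t)) -> circle_mean f r = circle_mean g r.
Proof.
intros H; unfold circle_mean; f_equal; apply RInt_ext; intros t _; now rewrite H.
Qed.

Lemma punctured_disc_neq_0 (z : C) : punctured_disc z -> z <> 0%C.
Proof. intros [H _]; now apply Cmod_gt_0. Qed.

(** The part b3 + z B(z) tends to b3 at 0, which determines its mean. The negative powers are total
    derivatives along the circle and have mean 0. *)
Lemma circle_mean_laurent (b0 b1 b2 b3 : C) (B dB : C -> C) (r : R) :
  C1_on unit_disc B dB -> 0 < r < 1 ->
  circle_mean (fun z => (b0 + b1 * z + b2 * z ^ 2 + b3 * z ^ 3 + z ^ 4 * B z) * (/ z) ^ 3)%C r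
  = Re b3.
Proof.
intros HB Hr.
assert (HB' : C1_on punctured_disc B dB).
{ apply (C1_on_subset unit_disc); [intros z [_ Hz]; exact Hz | exact HB]. }
assert (Hv : C1_on punctured_disc _ _) by
  exact (C1_on_inv _ _ _ (C1_on_id _) punctured_disc_neq_0).
assert (Hv2 := C1_on_mult _ _ _ _ _ Hv Hv).
assert (Hv3 := C1_on_mult _ _ _ _ _ Hv Hv2).
set (k c := C1_on_const punctured_disc c).
(* For psi = (i/k) z^(-k) one has i z psi'(z) = z^(-k). *)
assert (Hpsi := C1_on_plus _ _ _ _ _ (C1_on_mult _ _ _ _ _ (k (Ci * b2)%C) Hv)
  (C1_on_plus _ _ _ _ _ (C1_on_mult _ _ _ _ _ (k (Ci * b1 / 2)%C) Hv2)
   (C1_on_mult _ _ _ _ _ (k (Ci * b0 / 3)%C) Hv3))).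
assert (Hphi := C1_on_plus _ _ _ _ _ (k b3) (C1_on_mult _ _ _ _ _ (C1_on_id _) HB')).
assert (Hpol : forall t, punctured_disc (polar r t))
  by (intros t; apply punctured_polar; exact Hr).
rewrite (circle_mean_ext _ (fun z => (b3 + z * B z) +
   (b2 * (/ z) + (b1 * (/ z * / z) + b0 * (/ z * (/ z * / z)))))%C).
2:{ intros t; pose proof (punctured_disc_neq_0 _ (Hpol t)). simpl; field; assumption. }
rewrite circle_mean_plus.
- assert (Hz : Ccontinuous B (RtoC 0)).
  { eapply C1_on_continuous; [exact HB|]. unfold unit_disc; rewrite Cmod_0; lra. }
  destruct (locally_bounded B Hz) as (d & K & Hd & HK).
  rewrite (circle_mean_limit _ _ b3 K d r Hphi Hd).
  + rewrite <- (Rplus_0_r (Re b3)) at 2; f_equal.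
    etransitivity; [|exact (circle_mean_tangent _ _ _ r Hpsi Hpol)].
    apply circle_mean_ext; intros t.
    pose proof (punctured_disc_neq_0 _ (Hpol t)).
    generalize dependent (polar r t). intros z Hz0.
    assert (I : (Ci * Ci = -1)%C) by (apply injective_projections; simpl; ring).
    transitivity (- (Ci * Ci) * (b2 * (/ z) + (b1 * (/ z * / z) + b0 * (/ z * (/ z * / z)))))%C.
    * rewrite I; ring.
    * field. repeat split; auto; intros E; apply (f_equal fst) in E; simpl in E; lra.
  + intros z Hzd. replace (b3 + z * B z - b3)%C with (B z * z)%C by ring.
    rewrite Cmod_mult. apply Rmult_le_compat_r; [apply Cmod_ge_0 | apply HK; lra].
  + exact Hr.
- intros t. exact (C1_on_continuous _ _ _ _ Hphi (Hpol t)).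
- intros t.
  exact (C1_on_continuous _ _ _ _ (C1_on_plus _ _ _ _ _ (C1_on_mult _ _ _ _ _ (k b2) Hv)
   (C1_on_plus _ _ _ _ _ (C1_on_mult _ _ _ _ _ (k b1) Hv2)
   (C1_on_mult _ _ _ _ _ (k b0) Hv3))) (Hpol t)).
Qed.

(** * Moments of functions with nonnegative real part *)

Definition expands3 (p : C -> C) (c1 c2 c3 : C) : Prop :=
  exists B dB, C1_on unit_disc B dB /\ forall z, unit_disc z ->
    p z = (1 + c1 * z + c2 * z ^ 2 + c3 * z ^ 3 + z ^ 4 * B z)%C.

(** The general real trigonometric polynomial of degree at most 3, [polar 1 t] being e^(it). *)
Definition trig3 (al : R) (be ga de : C) (t : R) : R :=
  let E := polar 1 t in
  al + Re (be * E)%C + Re (ga * E ^ 2)%C + Re (de * E ^ 3)%C.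

(** The right-hand side is the mean over |z| = r of Re p times the trigonometric polynomial T, a
    product of nonnegative functions. *)
Lemma trig3_moment_lt1 (p : C -> C) (c1 c2 c3 : C) (al : R) (be ga de : C) (r : R) :
  expands3 p c1 c2 c3 -> (forall z, unit_disc z -> 0 <= Re (p z)) ->
  (forall t, 0 <= trig3 al be ga de t) -> 0 < r < 1 ->
  0 <= al + (r * Re (c1 * Cconj be)%C + r ^ 2 * Re (c2 * Cconj ga)%C
             + r ^ 3 * Re (c3 * Cconj de)%C) / 2.
Proof.
intros (B & dB & HB & Hp) Hpos HT Hr.
assert (Hpol : forall t, unit_disc (polar r t))
  by (intros t; apply (punctured_polar r t Hr)).
(* On |z| = r, e^(it) = z/r and e^(-it) = r/z; this makes [q0], ..., [q6] the coefficients of z^3 T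
   as a polynomial in z. *)
set (s := RtoC (/ r)).
set (q0 := (Cconj de * RtoC (r ^ 3) / 2)%C).
set (q1 := (Cconj ga * RtoC (r ^ 2) / 2)%C).
set (q2 := (Cconj be * RtoC r / 2)%C).
set (q3 := RtoC al).
set (q4 := (be * s / 2)%C).
set (q5 := (ga * s ^ 2 / 2)%C).
set (q6 := (de * s ^ 3 / 2)%C).
(* Multiplying p by Q(z) = z^3 T, a polynomial on the circle |z| = r, puts the moment in the coefficient of z^3. *)
assert (HA : exists dA, C1_on unit_disc (fun z =>
  B z * (q0 + z * (q1 + z * (q2 + z * (q3 + z * (q4 + z * (q5 + z * q6)))))) +
  ((q4 + c1 * q3 + c2 * q2 + c3 * q1) + z * ((q5 + c1 * q4 + c2 * q3 + c3 * q2) +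
  z * ((q6 + c1 * q5 + c2 * q4 + c3 * q3) + z * ((c1 * q6 + c2 * q5 + c3 * q4) +
  z * ((c2 * q6 + c3 * q5) + z * (c3 * q6)))))))%C dA).
{ eexists.
  C1_split; exact HB. }
destruct HA as [dA HA].
pose proof (circle_mean_laurent q0 (q1 + c1 * q0) (q2 + c1 * q1 + c2 * q0)
  (q3 + c1 * q2 + c2 * q1 + c3 * q0) _ _ r HA Hr) as M.
(* The moment is the real part of the coefficient of z^3 in p Q. *)
replace (al + _) with (Re (q3 + c1 * q2 + c2 * q1 + c3 * q0)%C).
2:{ unfold q3, q2, q1, q0, Cdiv. rewrite !re_plus, !Cmult_assoc, re_RtoC.
    rewrite <- RtoC_inv by lra. rewrite !re_scal_r. lra. }
rewrite <- M; apply circle_mean_ge_0.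
- intros t.
  eapply C1_on_continuous; [|exact (punctured_polar r t Hr)].
  cbn [Cpow].
  C1_split;
    first [ exact (C1_on_inv _ _ _ (C1_on_id _) punctured_disc_neq_0)
          | exact (C1_on_subset _ _ _ _ (fun z (H : punctured_disc z) => proj2 H) HB)].
- intros t.
  pose proof (Hpol t) as Hz.
  assert (HE : polar r t = (r * polar 1 t)%C)
    by (unfold polar; apply injective_projections; simpl; ring).
  assert (HE1 : (polar 1 t * Cconj (polar 1 t))%C = 1%C).
  { unfold polar; pose proof (sin2_cos2 t); unfold Rsqr in *.
    apply injective_projections; simpl; lra. }
  pose proof (Hp _ Hz) as Hpz.
  set (F := (_ * (/ polar r t) ^ 3)%C).
  (* On the circle the integrand is p(z) times the real number T(t), so its real part is
     nonnegative. *)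
  replace F with (p (polar r t) * RtoC (trig3 al be ga de t))%C.
  + rewrite re_scal_r. apply Rmult_le_pos; auto.
  + unfold F. clear F.
    match goal with |- _ = (?A * _)%C => replace A with
      (p (polar r t) * (q0 + polar r t * (q1 + polar r t * (q2 + polar r t * (q3 + polar r t *
       (q4 + polar r t * (q5 + polar r t * q6)))))))%C by (rewrite Hpz; simpl; ring) end.
    rewrite <- Cmult_assoc; f_equal.
    unfold trig3. set (E := polar 1 t) in *.
    rewrite !RtoC_plus, !re_alt, !Cmult_conj, !Cpow_conj, HE.
    unfold q0, q1, q2, q3, q4, q5, q6, s.
    assert (HE0 : E <> 0%C).
    { intros Z; rewrite Z in HE1. apply (f_equal fst) in HE1; simpl in HE1; lra. }
    replace (Cconj E) with (/ E)%C by (rewrite <- (Cmult_1_r (/ E)), <- HE1; field; auto).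
    rewrite !RtoC_pow, RtoC_inv by lra.
    assert (Hr0 : RtoC r <> 0%C) by (intros Z; apply (f_equal fst) in Z; simpl in Z; lra).
    simpl Cpow. field. repeat split; auto.
Qed.

(** The moment at radius r < 1 is a polynomial in r; a negative value at r = 1 would persist at some
    r < 1 by continuity. *)
Lemma trig3_moment (p : C -> C) (c1 c2 c3 : C) (al : R) (be ga de : C) :
  expands3 p c1 c2 c3 -> (forall z, unit_disc z -> 0 <= Re (p z)) ->
  (forall t, 0 <= trig3 al be ga de t) ->
  0 <= al + (Re (c1 * Cconj be)%C + Re (c2 * Cconj ga)%C + Re (c3 * Cconj de)%C) / 2.
Proof.
intros Hp Hpos HT.
set (x1 := Re (c1 * Cconj be)%C); set (x2 := Re (c2 * Cconj ga)%C);
set (x3 := Re (c3 * Cconj de)%C).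
set (g := fun r : R => al + (r * x1 + r ^ 2 * x2 + r ^ 3 * x3) / 2).
assert (Hg : continuous g 1).
{ apply (ex_derive_continuous (K := R_AbsRing) (V := R_NormedModule)).
  unfold g; auto_derive; auto. }
replace (al + _) with (g 1) by (unfold g; field).
apply Rnot_lt_le; intros Hneg.
destruct (Hg (fun y => y < 0) (open_lt 0 (g 1) Hneg)) as [d Hd].
set (r := Rmax (1 / 2) (1 - d / 2)).
pose proof (cond_pos d).
assert (Hr : 0 < r < 1 /\ 1 - d / 2 <= r).
{ unfold r; repeat split; [eapply Rlt_le_trans; [|apply Rmax_l]; lra
   | apply Rmax_lub_lt; lra | apply Rmax_r]. }
assert (B : g r < 0).
{ apply (Hd r). change (Rabs (r - 1) < d). rewrite Rabs_left; lra. }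
pose proof (trig3_moment_lt1 _ _ _ _ _ _ _ _ r Hp Hpos HT (proj1 Hr)).
unfold g, x1, x2, x3 in B. lra.
Qed.

(** * Caratheodory's inequalities *)

(** For |u| = 1 one has (1 + u)^2 = u |1 + u|^2, so (1 + u) / |1 + u| is a square root unless u =
    -1, where i serves. *)
Lemma unit_square_root (u : C) : Cmod u = 1 -> exists s : C, Cmod s = 1 /\ (s * s)%C = u.
Proof.
intros Hu.
assert (Hu2 : (u * Cconj u)%C = 1%C) by (rewrite <- Cmod2_conj, Hu; f_equal; ring).
destruct (Ceq_dec (1 + u) 0) as [E|E].
- exists Ci; split; [apply Cmod_Ci|].
  replace u with (1 + u - 1)%C by ring. rewrite E.
  apply injective_projections; simpl; ring.
- assert (M : 0 < Cmod (1 + u)) by now apply Cmod_gt_0.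
  assert (M0 : RtoC (Cmod (1 + u)) <> 0%C)
    by (intros Z; apply (f_equal fst) in Z; simpl in Z; lra).
  exists ((1 + u) / RtoC (Cmod (1 + u)))%C; split.
  + rewrite Cmod_div, Cmod_R, Rabs_pos_eq; [field; lra | lra | exact M0].
  + pose proof (Cmod2_conj (1 + u)) as Q. rewrite Cplus_conj in Q.
    replace (Cconj 1) with (RtoC 1) in Q by (apply injective_projections; simpl; ring).
    assert (Q' : ((1 + u) * (1 + Cconj u) * u = (1 + u) * (1 + u))%C).
    { transitivity ((1 + u) * (u + u * Cconj u))%C; [ring | rewrite Hu2; ring]. }
    rewrite <- Q, RtoC_pow in Q'.
    transitivity ((1 + u) * (1 + u) / (RtoC (Cmod (1 + u)) ^ 2))%C;
      [simpl; field; exact M0|].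
    rewrite <- Q'. field. exact M0.
Qed.

(** The rotation u = - conj c / |c| turns c u into -|c|. *)
Lemma Cmod_le_of_rotations (c : C) (B : R) :
  (forall u, Cmod u = 1 -> - B <= Re (c * u)%C) -> Cmod c <= B.
Proof.
intros H. destruct (Ceq_dec c 0) as [->|E].
- specialize (H 1%C Cmod_1). rewrite Cmult_0_l, re_RtoC in H. rewrite Cmod_0; lra.
- apply Cmod_gt_0 in E as M.
  assert (M0 : RtoC (Cmod c) <> 0%C)
    by (intros Z; apply (f_equal fst) in Z; simpl in Z; lra).
  specialize (H (- Cconj c / RtoC (Cmod c))%C).
  rewrite Cmod_div, Cmod_opp, Cmod_conj, Cmod_R, Rabs_pos_eq in H by (auto; lra).
  specialize (H ltac:(field; lra)).
  replace (c * (- Cconj c / RtoC (Cmod c)))%C with (RtoC (- Cmod c)) in H.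
  + rewrite re_RtoC in H; lra.
  + transitivity (- (c * Cconj c) / RtoC (Cmod c))%C.
    * rewrite <- Cmod2_conj, RtoC_pow, RtoC_opp. simpl; field; exact M0.
    * field; exact M0.
Qed.

(** The kernel 1 + Re (conj u e^(3it)) is nonnegative and its moment is 1 + Re (c3 u) / 2. *)
Lemma Caratheodory_c3 (p : C -> C) (c1 c2 c3 : C) :
  expands3 p c1 c2 c3 -> (forall z, unit_disc z -> 0 <= Re (p z)) -> Cmod c3 <= 2.
Proof.
intros Hp Hpos; apply Cmod_le_of_rotations; intros u Hu.
pose proof (trig3_moment p c1 c2 c3 1 0 0 (Cconj u) Hp Hpos) as H.
rewrite Cconj_conj in H.
replace (Cconj 0) with (RtoC 0) in H by (apply injective_projections; simpl; ring).
rewrite !Cmult_0_r, re_RtoC in H.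
enough (0 <= 1 + (0 + 0 + Re (c3 * u)%C) / 2) by lra.
apply H; intros t; unfold trig3.
rewrite !Cmult_0_l, re_RtoC.
pose proof (re_le_Cmod (Cconj u * polar 1 t ^ 3)) as B.
rewrite Cmod_mult, Cmod_conj, Cmod_pow, Cmod_polar, Hu, Rabs_R1 in B.
apply Rabs_le_between in B. lra.
Qed.

(** With u = s^2, a squared kernel yields 2 + Re (c2 s^2) - (Re (c1 s))^2 >= 0, and 2 (Re (c1 s))^2
    = |c1|^2 + Re (c1^2 s^2). *)
Lemma Caratheodory_c2 (p : C -> C) (c1 c2 c3 : C) :
  expands3 p c1 c2 c3 -> (forall z, unit_disc z -> 0 <= Re (p z)) ->
  Cmod (c2 - c1 ^ 2 / 2) <= 2 - Cmod c1 ^ 2 / 2.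
Proof.
intros Hp Hpos; apply Cmod_le_of_rotations; intros u Hu.
destruct (unit_square_root u Hu) as (s & Hs & <-).
set (m := - Re (c1 * s)%C).
set (e := Cconj s).
assert (Hse : (Re s * Re s + Im s * Im s = 1)).
{ pose proof (Cmod2_alt s) as Q; rewrite Hs in Q. simpl in Q; lra. }
(* The kernel is (m + 2 Re (e E))^2, with m chosen to minimise the moment. *)
pose proof (trig3_moment p c1 c2 c3 (m ^ 2 + 2) (RtoC (4 * m) * e) (2 * (e * e)) 0 Hp Hpos) as H.
assert (T : forall t, 0 <= trig3 (m ^ 2 + 2) (RtoC (4 * m) * e) (2 * (e * e)) 0 t).
{ intros t. unfold trig3.
  replace (_ + _) with ((m + 2 * Re (e * polar 1 t)%C) ^ 2); [apply pow2_ge_0|].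
  pose proof (sin2_cos2 t) as SC; unfold Rsqr in SC.
  unfold e, polar. destruct s as [s1 s2]; simpl in *.
  generalize dependent (sin t); generalize dependent (cos t); intros c s SC.
  (* As |e E| = 1, the square (Re (e E))^2 equals (1 + Re (e^2 E^2)) / 2. *)
  assert (X : (s1 * s1 + s2 * s2) * (s * s + c * c) = 1) by (rewrite Hse, SC; ring).
  clear - X. ring_simplify. ring_simplify in X. lra. }
specialize (H T).
replace (Cconj 0) with (RtoC 0) in H by (apply injective_projections; simpl; ring).
rewrite Cmult_0_r, re_RtoC, Rplus_0_r, !Cmult_conj in H.
unfold e in H; rewrite !Cconj_conj in H.
replace (Cconj (RtoC (4 * m))) with (RtoC (4 * m)) in H by (apply injective_projections; simpl; ring).
replace (Cconj (RtoC 2)) with (RtoC 2) in H by (apply injective_projections; simpl; ring).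
rewrite Cmod2_alt. unfold m in H.
destruct s as [s1 s2], c1 as [x1 y1], c2 as [x2 y2].
simpl in *.
assert (X : (x1 * x1 + y1 * y1) * (s1 * s1 + s2 * s2) = x1 * x1 + y1 * y1) by (rewrite Hse; ring).
field_simplify. field_simplify in H. field_simplify in X.
nra.
Qed.

(** * Convex functions *)

Lemma unit_disc_nbhs (z : C) :
  unit_disc z -> exists d : posreal, forall w, Cmod (w - z) < d -> unit_disc w.
Proof.
unfold unit_disc; intros Hz.
assert (Hd : 0 < 1 - Cmod z) by lra.
exists (mkposreal _ Hd); simpl; intros w Hw.
pose proof (Cmod_triangle (w - z) z) as T.
replace (w - z + z)%C with w in T by ring. lra.
Qed.

Lemma is_Cderive_ext_disc (f g : C -> C) (z l : C) :
  unit_disc z -> (forall w, unit_disc w -> f w = g w) ->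
  is_Cderive f z l -> is_Cderive g z l.
Proof.
intros Hz E. apply is_derive_ext_loc.
destruct (unit_disc_nbhs z Hz) as [d Hd]; exists d; intros w Hw.
apply E, Hd, Hw.
Qed.

Lemma C_derive_disc (f : C -> C) (b : nat -> C) (z : C) :
  disc_coefs b -> (forall w, unit_disc w -> Cpseries b w = f w) -> unit_disc z ->
  C_derive f z = Cpseries (Cps_derive b) z.
Proof.
intros Hb Hf Hz; apply is_C_derive_unique.
apply (is_Cderive_ext_disc (Cpseries b)); auto.
now apply is_Cderive_Cpseries.
Qed.

Lemma C1_on_Cpseries (b : nat -> C) :
  disc_coefs b -> C1_on unit_disc (Cpseries b) (Cpseries (Cps_derive b)).
Proof.
intros Hb z Hz; split; [now apply is_Cderive_Cpseries|].
eapply is_Cderive_continuous; apply is_Cderive_Cpseries; auto using disc_coefs_derive.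
Qed.

Lemma Cpseries_0 (b : nat -> C) : disc_coefs b -> Cpseries b 0 = b 0%nat.
Proof.
intros Hb.
rewrite (proj2 (Cpseries_incr b 0 Hb ltac:(unfold unit_disc; rewrite Cmod_0; lra))).
ring.
Qed.

(* On each ray, |z G(z)|^2 is nondecreasing, because its radial derivative is 2 r Re (conj G (G + z G')). *)
Lemma ray_monotone_neq_0 (G dG : C -> C) :
  C1_on unit_disc G dG -> G 0%C <> 0%C ->
  (forall z, unit_disc z -> G z <> 0%C -> 0 <= Re (1 + z * dG z / G z)%C) ->
  forall z, unit_disc z -> G z <> 0%C.
Proof.
intros HG H0 Hpos z Hz Gz.
destruct (Ceq_dec z 0) as [->|Ez]; [now apply H0|].
apply Cmod_gt_0 in Ez as Mz.
set (S := fun w => (w * G w)%C).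
assert (HS := C1_on_mult _ _ _ _ _ (C1_on_id unit_disc) HG).
set (gx := fun s : R => s * fst z); set (gy := fun s : R => s * snd z).
assert (Hg : forall s, (gx s, gy s) = (s * z)%C)
  by (intros s; unfold gx, gy; apply injective_projections; simpl; ring).
assert (Hs : forall s, 0 <= s <= 1 -> unit_disc (gx s, gy s)).
{ intros s Hs; rewrite Hg; unfold unit_disc in *.
  rewrite Cmod_mult, Cmod_R, Rabs_pos_eq by lra. pose proof (Cmod_ge_0 z); nra. }
(* Since Im S = Re (-i S), this is |S|^2 along the ray, in a form that [is_derive_Re_curve]
   differentiates. *)
set (N := fun s : R => Re (S (gx s, gy s)) ^ 2 + Re (- Ci * S (gx s, gy s))%C ^ 2).
assert (HN : forall s, N s = Cmod (S (gx s, gy s)) ^ 2).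
{ intros s; unfold N; rewrite Cmod2_alt, re_mult; simpl; ring. }
assert (Hx : forall s, is_derive gx s (fst z)) by (intros s; unfold gx; auto_derive; auto; ring).
assert (Hy : forall s, is_derive gy s (snd z)) by (intros s; unfold gy; auto_derive; auto; ring).
assert (HS2 := C1_on_mult _ _ _ _ _ (C1_on_const unit_disc (- Ci)%C) HS).
set (dN := fun s : R => 2 * s * Cmod z ^ 2 *
   Re (Cconj (G (gx s, gy s)) * (G (gx s, gy s) + (gx s, gy s) * dG (gx s, gy s)))%C).
assert (DN : forall s, 0 <= s <= 1 -> is_derive N s (dN s)).
{ intros s Hs'.
  pose proof (is_derive_Re_curve _ gx gy s _ _ _ (proj1 (HS _ (Hs s Hs'))) (Hx s) (Hy s)) as D1.
  pose proof (is_derive_Re_curve _ gx gy s _ _ _ (proj1 (HS2 _ (Hs s Hs'))) (Hx s) (Hy s)) as D2.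
  pose proof (is_derive_plus (K := R_AbsRing) (V := R_NormedModule) _ _ _ _ _
    (is_derive_pow _ 2 _ _ D1) (is_derive_pow _ 2 _ _ D2)) as D.
  match type of D with is_derive _ _ ?d => replace (dN s) with d; [exact D|] end.
  unfold dN. rewrite Cmod2_alt. unfold gx, gy.
  generalize (G (s * fst z, s * snd z)) (dG (s * fst z, s * snd z)).
  intros [g1 g2] [h1 h2]; unfold plus; simpl; unfold Re, Im; ring. }
assert (PN : forall s, 0 <= s <= 1 -> 0 <= dN s).
{ intros s Hs'. unfold dN.
  apply Rmult_le_pos; [apply Rmult_le_pos; [lra | apply pow2_ge_0]|].
  pose proof (Hpos _ (Hs s Hs')) as Hp.
  (* Where [G] vanishes so does [dN]; elsewhere the hypothesis on the real part decides the sign. *)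
  destruct (Ceq_dec (G (gx s, gy s)) 0) as [E|E].
  - rewrite E. replace (Cconj 0) with (RtoC 0) by (apply injective_projections; simpl; ring).
    rewrite Cmult_0_l, re_RtoC; lra.
  - specialize (Hp E).
    replace (Cconj _ * _)%C with (RtoC (Cmod (G (gx s, gy s)) ^ 2) *
      (1 + (gx s, gy s) * dG (gx s, gy s) / G (gx s, gy s)))%C.
    + rewrite re_scal_l; apply Rmult_le_pos; [apply pow2_ge_0 | exact Hp].
    + rewrite Cmod2_conj. field; exact E. }
assert (N1 : N 1 = 0).
{ rewrite HN, Hg, Cmult_1_l. unfold S; rewrite Gz, Cmult_0_r, Cmod_0; ring. }
(* [N] is nonnegative, nondecreasing and zero at 1, so the zero at [z] forces [G] to vanish on the
   open segment from 0 to [z]. *)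
assert (Nz : forall s, 0 < s < 1 -> G (gx s, gy s) = 0%C).
{ intros s Hs'.
  assert (N s <= N 1).
  { destruct (MVT_gen N s 1 dN) as (c & Hc & E).
    - intros x; rewrite Rmin_left, Rmax_right by lra; intros; apply DN; lra.
    - intros x; rewrite Rmin_left, Rmax_right by lra; intros.
      apply derivable_continuous_pt. exists (dN x). apply is_derive_Reals, DN; lra.
    - rewrite Rmin_left, Rmax_right in Hc by lra.
      pose proof (PN c ltac:(lra)). nra. }
  rewrite N1, HN in H.
  pose proof (Cmod_ge_0 (S (gx s, gy s))).
  assert (Z : Cmod (S (gx s, gy s)) = 0) by nra.
  apply Cmod_eq_0 in Z. unfold S in Z.
  destruct (Ceq_dec (G (gx s, gy s)) 0) as [|E]; [assumption|].
  exfalso; apply (Cmult_neq_0 (gx s, gy s) (G (gx s, gy s))); auto.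
  rewrite Hg. apply Cmult_neq_0; [|exact (proj2 (Cmod_gt_0 z) Mz)].
  intros X; apply (f_equal fst) in X; simpl in X; lra. }
(* Continuity and G(0) <> 0 exclude zeros of [G] near 0, where the segment accumulates. *)
assert (C0 : Ccontinuous G (RtoC 0)).
{ eapply C1_on_continuous; [exact HG|]. unfold unit_disc; rewrite Cmod_0; lra. }
apply Cmod_gt_0 in H0.
assert (B : locally (T := C_UniformSpace) (G 0%C) (fun y => Cmod (y - G 0%C) < Cmod (G 0%C))).
{ apply locally_C. exists (mkposreal _ H0). intros y Hy'; exact Hy'. }
apply C0 in B. apply locally_C in B. destruct B as [d Hd].
set (s := Rmin (1 / 2) (d / 2)).
pose proof (cond_pos d).
assert (Hs0 : 0 < s <= 1 / 2 /\ s <= d / 2)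
  by (unfold s; repeat split; [apply Rmin_pos; lra | apply Rmin_l | apply Rmin_r]).
specialize (Nz s ltac:(lra)).
specialize (Hd (gx s, gy s)).
rewrite Nz in Hd.
replace (0 - G 0%C)%C with (- G 0%C)%C in Hd by ring.
rewrite Cmod_opp in Hd.
enough (Cmod (G 0%C) < Cmod (G 0%C)) by lra.
apply Hd. change (Cmod ((gx s, gy s) - 0) < d).
rewrite Hg. replace (s * z - 0)%C with (s * z)%C by ring.
rewrite Cmod_mult, Cmod_R, Rabs_pos_eq by lra.
unfold unit_disc in Hz. nra.
Qed.

(** * Taylor coefficients of 1 + z f''/f' *)

Definition normalized_coefs (a : nat -> C) (n : nat) : C :=
  match n with 0%nat => 0%C | 1%nat => 1%C | _ => a n end.

Lemma normalized_expansion_series (f : C -> C) (a : nat -> C) (z : C) :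
  normalized_expansion f a -> unit_disc z ->
  is_Cseries (fun n => normalized_coefs a n * z ^ n)%C (f z).
Proof.
intros H Hz.
apply is_series_decr_1, is_series_decr_1.
match goal with |- is_series _ ?l => replace l with (f z - z)%C end.
- apply (is_series_ext (K := C_AbsRing) (V := C_NormedModule)
    (fun k => a (k + 2)%nat * z ^ (k + 2))%C).
  + intros n; replace (n + 2)%nat with (S (S n)) by lia; reflexivity.
  + exact (H z Hz).
- change (@eq C (f z - z) (f z + - (0 * 1) + - (1 * (z * 1))))%C. ring.
Qed.

(** Comparing coefficients in z f'' = (p - 1) f' gives 2 a2 = c1, 6 a3 = c2 + 2 a2 c1 and 12 a4 = c3
    + 2 a2 c2 + 3 a3 c1, to be solved for c1, c2, c3. *)
Lemma convex_expands3 (f : C -> C) (a : nat -> C) :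
  normalized_expansion f a -> convex_class f ->
  exists p,
    expands3 p (2 * a 2%nat) (6 * a 3%nat - 4 * a 2%nat ^ 2)
      (12 * a 4%nat - 18 * a 2%nat * a 3%nat + 8 * a 2%nat ^ 3) /\
    forall z, unit_disc z -> 0 <= Re (p z).
Proof.
intros Ha [_ Hconv].
set (b := normalized_coefs a).
assert (Hb : disc_coefs b).
{ apply disc_coefs_of_convergent; intros z Hz.
  exists (f z); now apply normalized_expansion_series. }
assert (Hf : forall w, unit_disc w -> Cpseries b w = f w)
  by (intros w Hw; apply is_Cseries_Cpseries, normalized_expansion_series; auto).
pose proof (disc_coefs_derive _ Hb) as Hb1.
pose proof (disc_coefs_derive _ Hb1) as Hb2.
set (e := Cps_derive b) in *. set (e' := Cps_derive e) in *.
assert (D1 : forall z, unit_disc z -> Cpseries e z = C_derive f z)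
  by (intros z Hz; symmetry; apply C_derive_disc; auto).
assert (D2 : forall z, unit_disc z -> C_derive (C_derive f) z = Cpseries e' z)
  by (intros z Hz; apply C_derive_disc; auto).
assert (E0 : e 0%nat = 1%C) by (unfold e, Cps_derive, b; simpl; ring).
assert (E1 : e 1%nat = (2 * a 2%nat)%C).
{ unfold e, Cps_derive, b; simpl. rewrite RtoC_plus; ring. }
assert (E2 : e 2%nat = (3 * a 3%nat)%C).
{ unfold e, Cps_derive, b; simpl. rewrite !RtoC_plus; ring. }
assert (E3 : e 3%nat = (4 * a 4%nat)%C).
{ unfold e, Cps_derive, b; simpl. rewrite !RtoC_plus; ring. }
assert (Hpos : forall z, unit_disc z ->
  0 <= Re (1 + z * Cpseries e' z / Cpseries e z)%C).
{ intros z Hz. rewrite D1, <- D2 by auto. apply Rlt_le, Hconv, Hz. }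
(* As f'(0) = 1, the convexity inequality keeps f' from vanishing, so the quotient z f''/f' is
   differentiable on the disc. *)
assert (Hne : forall z, unit_disc z -> Cpseries e z <> 0%C).
{ apply (ray_monotone_neq_0 _ _ (C1_on_Cpseries e Hb1)); auto.
  rewrite Cpseries_0, E0 by auto.
  intros X; apply (f_equal fst) in X; simpl in X; lra. }
set (sh := fun (u : nat -> C) n => u (S n)).
assert (Hsh : forall u, disc_coefs u -> disc_coefs (sh u)).
{ intros u Hu; apply (Cpseries_incr u 0 Hu). unfold unit_disc; rewrite Cmod_0; lra. }
assert (Hexp : forall u z, disc_coefs u -> unit_disc z ->
  Cpseries u z = (u 0%nat + z * Cpseries (sh u) z)%C)
  by (intros u z Hu Hz; apply Cpseries_incr; auto).
(* The tails of f' after four terms and of f'' after three: the factor z in z f'' brings both to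
   order z^4. *)
set (R1 := sh (sh (sh (sh e)))). set (R2 := sh (sh (sh e'))).
assert (HR1 : disc_coefs R1) by (unfold R1; auto).
assert (HR2 : disc_coefs R2) by (unfold R2; auto).
exists (fun z => 1 + z * Cpseries e' z / Cpseries e z)%C; split; [|exact Hpos].
set (c1 := (2 * a 2%nat)%C).
set (c2 := (6 * a 3%nat - 4 * a 2%nat ^ 2)%C).
set (c3 := (12 * a 4%nat - 18 * a 2%nat * a 3%nat + 8 * a 2%nat ^ 3)%C).
(* With P = 1 + c1 z + c2 z^2 + c3 z^3, the witness is (z f'' - (P - 1) f') / (z^4 f'). The choice
   of [c1], [c2], [c3] cancels the orders up to 3, and what is left is written without dividing by
   z. *)
eexists (fun z => (Cpseries R2 z +
  ((-1) * (c1 * e 3%nat + c2 * e 2%nat + c3 * e 1%nat) +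
   z * ((-1) * (c2 * e 3%nat + c3 * e 2%nat) + z * ((-1) * c3 * e 3%nat)) +
  (-1) * (z * (c1 + z * (c2 + z * c3)) * Cpseries R1 z))) * (/ Cpseries e z))%C, _.
split.
- C1_split.
  + exact (C1_on_Cpseries R2 HR2).
  + exact (C1_on_Cpseries R1 HR1).
  + exact (C1_on_inv _ _ _ (C1_on_Cpseries e Hb1) Hne).
- intros z Hz.
  assert (X1 : Cpseries e z = (e 0%nat + e 1%nat * z + e 2%nat * z ^ 2 + e 3%nat * z ^ 3
     + z ^ 4 * Cpseries R1 z)%C).
  { unfold R1; rewrite (Hexp e), (Hexp (sh e)), (Hexp (sh (sh e))),
      (Hexp (sh (sh (sh e)))) by auto.
    unfold sh; simpl; ring. }
  assert (X2 : Cpseries e' z = (e 1%nat + 2 * e 2%nat * z + 3 * e 3%nat * z ^ 2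
     + z ^ 3 * Cpseries R2 z)%C).
  { unfold R2; rewrite (Hexp e'), (Hexp (sh e')), (Hexp (sh (sh e'))) by auto.
    unfold sh, e', Cps_derive; simpl; rewrite !RtoC_plus; ring. }
  pose proof (Hne z Hz) as Hz0.
  transitivity ((Cpseries e z + z * Cpseries e' z) / Cpseries e z)%C; [field; exact Hz0|].
  match goal with |- _ = (?P + z ^ 4 * (?N * / _))%C =>
    transitivity ((P * Cpseries e z + z ^ 4 * N) / Cpseries e z)%C;
      [unfold Cdiv; f_equal | field; exact Hz0] end.
  rewrite X1, X2, E0, E1, E2, E3. unfold c1, c2, c3. simpl; ring.
Qed.

(** * The bound on the second Hankel determinant *)

Theorem corollary2p4 (f : C -> C) (a : nat -> C)
    (hfa : normalized_expansion f a) (hf : bi_convex f) :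
  (Cmod (a 2%nat * a 4%nat - a 3%nat ^ 2)%C <= 1 / 3)%R.
Proof.
destruct hf as (_ & Hconv & _).
destruct (convex_expands3 f a hfa Hconv) as (p & Hp & Hpos).
pose proof (Caratheodory_c3 _ _ _ _ Hp Hpos) as B3.
pose proof (Caratheodory_c2 _ _ _ _ Hp Hpos) as B2.
set (c1 := (2 * a 2%nat)%C) in *.
set (c3 := (12 * a 4%nat - 18 * a 2%nat * a 3%nat + 8 * a 2%nat ^ 3)%C) in *.
set (d := (_ - c1 ^ 2 / 2)%C) in *.
(* Twice the identity for 144 (a2 a4 - a3^2), which clears the coefficient 3/2. *)
replace (a 2%nat * a 4%nat - a 3%nat ^ 2)%C
  with (RtoC (1 / 288) * (12 * (c1 * c3) + - (3 * c1 ^ 4 + (6 * (c1 ^ 2 * d) + 8 * d ^ 2))))%C.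
2:{ unfold d, c1, c3. rewrite RtoC_div by lra. simpl. field. }
rewrite Cmod_mult, Cmod_R, Rabs_pos_eq by lra.
(* The constant is 96 = 288 / 3. *)
enough (Cmod (12 * (c1 * c3) + - (3 * c1 ^ 4 + (6 * (c1 ^ 2 * d) + 8 * d ^ 2))) <= 96) by lra.
eapply Rle_trans; [apply Cmod_triangle|].
rewrite Cmod_opp.
pose proof (Cmod_triangle (3 * c1 ^ 4) (6 * (c1 ^ 2 * d) + 8 * d ^ 2)).
pose proof (Cmod_triangle (6 * (c1 ^ 2 * d)) (8 * d ^ 2)).
rewrite !Cmod_mult, !Cmod_pow, !Cmod_R, !Rabs_pos_eq in * by lra.
pose proof (Cmod_ge_0 c1). pose proof (Cmod_ge_0 c3). pose proof (Cmod_ge_0 d).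
set (x := Cmod c1) in *. set (y := Cmod d) in *.
(* From 0 <= |d| <= 2 - x^2 / 2. *)
assert (x <= 2) by nra.
assert (x * Cmod c3 <= 2 * x) by nra.
assert (x ^ 2 * y <= x ^ 2 * (2 - x ^ 2 / 2))
  by (apply Rmult_le_compat_l; [apply pow2_ge_0 | exact B2]).
assert (y ^ 2 <= (2 - x ^ 2 / 2) ^ 2) by (apply pow_incr; lra).
(* The bounds add up to 32 + 24 x - 4 x^2 + 2 x^4, and 96 minus this polynomial is twice the product
   in [Q]. *)
assert (Q : 0 <= (2 - x) * (x ^ 3 + 2 * x ^ 2 + 2 * x + 16)).
{ apply Rmult_le_pos; [lra|]. pose proof (pow_le x 3); pose proof (pow_le x 2); lra. }
nra.
Qed.
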